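(* Let $\nu\in\mathbb R^n$ be a real common eigenvector of the matrices $A_j$ corresponding to the eigenvalues $\lambda^j$, $j=1,\ldots,m$, respectively. Then the completely solvable system $dx=\sum_{j=1}^m(B_jx+f_j(t))\,dt_j$ has the first integral $$F\colon(t,x)\to\nu x\cdot\varphi(t)-\int\sum_{j=1}^m\nu f_j(t)\cdot\varphi(t)\,dt_j\quad\text{for all }(t,x)\in\widetilde{\mathcal T}\times\mathbb R^n,$$ where $\widetilde{\mathcal T}$ is a simply connected domain in $\mathcal T$ and $\varphi(t)=\exp\bigl(-\sum_{j=1}^m\lambda^jt_j\bigr)$ for all $t\in\mathcal T$.
   Context: Let $x\in\mathbb R^n$, $t=(t_1,\ldots,t_m)\in\mathcal T$, with $\mathcal T\subset\mathbb R^m$ a domain. Let $A_1,\ldots,A_m$ be real $n\times n$ matrices, $B_j=A_j^T$, and $f_j\colon\mathcal T\to\mathbb R^n$ continuously differentiable, $j=1,\ldots,m$. The system in total differentials $dx=\sum_{j=1}^m(B_jx+f_j(t))dt_j$ is completely solvable when $A_jA_\zeta=A_\zeta A_j$ and $\partial_{t_\zeta}f_j(t)-B_\zeta f_j(t)=\partial_{t_j}f_\zeta(t)-B_jf_\zeta(t)$ for all $t\in\mathcal T$, $j,\zeta=1,\ldots,m$. For vectors, $\nu x=\sum_i\nu_ix_i$. The symbol $\int\omega$ for a 1-form $\omega$ on $\widetilde{\mathcal T}$ denotes a function whose differential is $\omega$. A continuously differentiable function $F(t,x)$ is a first integral if $\partial_{t_j}F+\sum_{i=1}^n(B_jx+f_j(t))_i\,\partial_{x_i}F=0$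 on its domain, $j=1,\ldots,m$. *)

(* Defs.v *)
From mathcomp Require Import all_boot all_order all_algebra.
From mathcomp Require Import all_classical all_reals all_analysis.

Set Implicit Arguments.
Unset Strict Implicit.
Unset Printing Implicit Defensive.

Import Order.TTheory GRing.Theory Num.Theory.
Import numFieldNormedType.Exports.

Local Open Scope classical_set_scope.
Local Open Scope ring_scope.

Definition domain (V : topologicalType) (U : set V) : Prop :=
  [/\ U !=set0, open U & connected U].

(* Paths are functions on R of which only the restriction to [0, 1] matters. *)
Definition path_connected (R : realType) (V : normedModType R) (U : set V)
    : Prop :=
  forall x y, U x -> U y ->
    exists g : R -> V,
      [/\ {within `[0, 1], continuous g}, forall s : R, s \in `[0, 1] -> U (g s),
          g 0 = x & g 1 = y].

(* Null-homotopy in U of the loop g, with endpoints fixed; in H (s, u) the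
   parameter of the loop is s and that of the homotopy is u. *)
Definition null_homotopic (R : realType) (V : normedModType R) (U : set V)
    (g : R -> V) : Prop :=
  exists H : R * R -> V,
    [/\ {within `[0, 1] `*` `[0, 1], continuous H},
        forall s u : R, s \in `[0, 1] -> u \in `[0, 1] -> U (H (s, u)),
        forall s : R, s \in `[0, 1] -> H (s, 0) = g s,
        forall s : R, s \in `[0, 1] -> H (s, 1) = g 0 &
        forall u : R, u \in `[0, 1] -> H (0, u) = g 0 /\ H (1, u) = g 0].

Definition simply_connected (R : realType) (V : normedModType R) (U : set V)
    : Prop :=
  path_connected U /\
  forall g : R -> V,
    {within `[0, 1], continuous g} ->
    (forall s : R, s \in `[0, 1] -> U (g s)) ->
    g 0 = g 1 ->
    null_homotopic U g.

(* Continuous differentiability on an open set U.  Here V is meant to be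
   finite-dimensional: continuity of p |-> 'd F p is then continuity of
   p |-> 'd F p v = 'D_v F p for each v. *)
Definition C1_on (R : realType) (V W : normedModType R) (U : set V)
    (F : V -> W) : Prop :=
  (forall p, U p -> differentiable F p) /\
  (forall v p, U p -> {for p, continuous (fun q => 'D_v F q)}).

Definition dotv (R : realType) (n : nat) (u x : 'cV[R]_n) : R :=
  \sum_(i < n) u i 0 * x i 0.

(* The partial derivative with respect to t_j is 'D_(delta_mx j 0). *)
Definition completely_solvable (R : realType) (m n : nat)
    (A : 'I_m -> 'M[R]_n) (f : 'I_m -> 'cV[R]_m -> 'cV[R]_n)
    (T : set 'cV[R]_m) : Prop :=
  (forall j k : 'I_m, A j *m A k = A k *m A j) /\
  (forall t, T t -> forall j k : 'I_m,
     'D_(delta_mx k 0) (f j) t - (A k)^T *m f j t =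
     'D_(delta_mx j 0) (f k) t - (A j)^T *m f k t).

(* First integral on D of dx = \sum_j (B_j x + f_j(t)) dt_j, p = (t, x). *)
Definition first_integral (R : realType) (m n : nat)
    (B : 'I_m -> 'M[R]_n) (f : 'I_m -> 'cV[R]_m -> 'cV[R]_n)
    (D : set ('cV[R]_m * 'cV[R]_n)) (F : 'cV[R]_m * 'cV[R]_n -> R) : Prop :=
  C1_on D F /\
  forall p, D p -> forall j : 'I_m,
    'D_(delta_mx j 0, 0) F p
    + \sum_(i < n) (B j *m p.2 + f j p.1) i 0 * 'D_(0, delta_mx i 0) F p = 0.

Definition is_common_eigenvector (R : realType) (m n : nat)
    (A : 'I_m -> 'M[R]_n) (nu : 'cV[R]_n) (lambda : 'I_m -> R) : Prop :=
  nu != 0 /\ forall j, A j *m nu = lambda j *: nu.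

(* On U, the differential of G is the 1-form \sum_j omega_j dt_j. *)
Definition primitive_on (R : realType) (m : nat) (U : set 'cV[R]_m)
    (omega : 'I_m -> 'cV[R]_m -> R) (G : 'cV[R]_m -> R) : Prop :=
  forall t, U t ->
    is_diff t G (fun v : 'cV[R]_m => \sum_(j < m) omega j t * v j 0).

Definition phi (R : realType) (m : nat) (lambda : 'I_m -> R) (t : 'cV[R]_m)
    : R :=
  expR (- \sum_(j < m) lambda j * t j 0).

(* Main.v *)
Require Import Defs.
From HB Require Import structures.
From mathcomp Require Import all_boot all_order all_algebra.
From mathcomp Require Import all_classical all_reals all_analysis.
From mathcomp Require Import ring lra.

Import Order.TTheory GRing.Theory Num.Theory.
Import numFieldNormedType.Exports.

Local Open Scope classical_set_scope.
Local Open Scope ring_scope.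

(** Since [A_j nu = lambda^j nu], pairing the system with [nu] turns it into
    the scalar system [d(nu x) = sum_j (lambda^j (nu x) + nu f_j(t)) dt_j],
    whose integrating factor is [phi].  Hence the derivative of
    [nu x * phi t] along the system in the direction [t_j] is
    [omega_j t = nu f_j(t) * phi t], and subtracting any primitive [G] of
    [omega] leaves a first integral: this is an explicit computation of
    partial derivatives.

    What needs an argument is that a primitive exists.  Pairing the
    integrability condition with [nu] gives
    [d_k omega_j = d_j omega_k] ([closed_dotv_phi]), so [omega] is a closed
    1-form of class C1, and the claim is the Poincare lemma on a simply
    connected open set ([closed_form_primitive]).  The proof separates
    analysis from topology through the function
    [segint p q = int_[p, q] omega].

    Analysis.  On a ball contained in [U], [segint] is additive:
    [segint p q + segint q s = segint p s].  Indeed, differentiating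
    [h |-> segint p (q + h v)] under the integral sign and using closedness,
    the integrand becomes the derivative in [s] of
    [s * omega(p + s (q + h v - p)) v]; the derivative is therefore
    [omega(q + h v) v], and integrating over [h] gives additivity.  Moreover
    a function that differs from [segint t] by a constant near [t] has
    differential [omega t] at [t], by continuity of [omega].

    Topology.  For any [c] that is additive on the balls contained in a simply
    connected open [U] there is a function [G] with [G q - G p = c p q]
    whenever [p] and [q] lie in a common such ball
    ([additive_on_balls_potential]).  The value of [G] at [x] is the sum of
    [c] along a chain of points from a base point to [x], two consecutive
    points lying in a common ball contained in [U].  It does not depend on the
    chain because a closed chain has sum zero ([closed_chain_sum]): the
    polygon through the chain contracts in [U]; by compactness a fine enough
    grid on the square of the homotopy has cells whose corners are sent into
    one ball of [U], additivity around each cell shows that two consecutive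
    rows have the same sum, and the last row is constant. *)

Set Implicit Arguments.
Unset Strict Implicit.
Unset Printing Implicit Defensive.

(** * Sums of a locally additive function along chains *)

(** Such a [c] is a locally exact 1-cochain; line integrals of a closed form
    over segments are the intended instance. *)
Definition additive_on_balls (R : realType) (V : normedModType R) (U : set V)
    (c : V -> V -> R) : Prop :=
  forall a r, ball a r `<=` U -> forall p q s,
    ball a r p -> ball a r q -> ball a r s -> c p q + c q s = c p s.

Definition close_in (R : realType) (V : normedModType R) (U : set V)
    (p q : V) : Prop :=
  exists a r, [/\ ball a r `<=` U, ball a r p & ball a r q].

Lemma close_in_sym (R : realType) (V : normedModType R) (U : set V)
    (p q : V) : close_in U p q -> close_in U q p.
Proof. by move=> [a [r [? ? ?]]]; exists a, r; split. Qed.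

Lemma additive_on_balls_refl (R : realType) (V : normedModType R) (U : set V)
    (c : V -> V -> R) (p : V) :
  open U -> additive_on_balls U c -> U p -> c p p = 0.
Proof.
move=> oU ca Up; have /nbhs_ballP[r r0 br] := open_nbhs_nbhs (conj oU Up).
have pr : ball p r p by exact: ballxx.
by have := ca _ _ br _ _ _ pr pr pr; lra.
Qed.

Lemma additive_on_balls_sym (R : realType) (V : normedModType R) (U : set V)
    (c : V -> V -> R) (p q : V) :
  open U -> additive_on_balls U c -> close_in U p q -> c q p = - c p q.
Proof.
move=> oU ca [a [r [br ap aq]]].
have := ca _ _ br _ _ _ ap aq ap.
have := additive_on_balls_refl oU ca (br _ ap); lra.
Qed.

(** The Lebesgue number lemma for the cover of [K] by the preimages of the
    balls contained in [U]; near-coverings give the uniform radius without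
    extracting a finite subcover. *)
Lemma lebesgue_number (R : realType) (V X : normedModType R)
    (U : set V) (K : set X) (H : X -> V) :
  open U -> compact K -> {within K, continuous H} ->
  (forall z, K z -> U (H z)) ->
  exists2 e : R, 0 < e & forall z, K z ->
    exists a r, ball a r `<=` U /\
      forall w, K w -> ball z e w -> ball a r (H w).
Proof.
move=> oU /compact_near_coveringP cK /subspace_continuousP cH HU.
pose P (e : R) z := exists a r, ball a r `<=` U /\
  forall w, K w -> ball z e w -> ball a r (H w).
suff : \forall e \near (0:R)^'+, K `<=` P e.
  move=> h; have [e [e0 he]] := filter_ex (filterI (nbhs_right_gt (0:R)) h).
  by exists e.
apply: cK => z Kz.
have /nbhs_ballP[r r0 br] := open_nbhs_nbhs (conj oU (HU z Kz)).
have := cH z Kz _ (nbhsx_ballx (H z) r r0).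
rewrite /within /= => /nbhs_ballP[d d0 bd].
exists (ball z (d / 2), [set e | e < d / 2]) => /=.
  split; first by apply: nbhsx_ballx; exact: divr_gt0.
  by apply: nbhs_right_lt; exact: divr_gt0.
move=> [z' e] /= [zz' ed]; exists (H z), r; split => // w Kw z'w.
apply: bd => //; apply: (ball_split zz').
exact: le_ball (ltW ed) _ z'w.
Qed.

(** Chains are kept as a relation between endpoints and sums because
    concatenation and reversal are then immediate; [chain_sum_seq] recovers
    the list of points where an actual polygon is needed. *)
Inductive chain_sum (R : realType) (V : normedModType R) (U : set V)
    (c : V -> V -> R) (p : V) : V -> R -> Prop :=
| chain_nil : chain_sum U c p p 0
| chain_step q s a : chain_sum U c p q a -> close_in U q s ->
    chain_sum U c p s (a + c q s).


Lemma chain_sum_cat (R : realType) (V : normedModType R) (U : set V)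
    (c : V -> V -> R) (p q s : V) (a b : R) :
  chain_sum U c p q a -> chain_sum U c q s b -> chain_sum U c p s (a + b).
Proof.
move=> pq; elim=> {s b} [|s t b _ ih st]; first by rewrite addr0.
by rewrite addrA; exact: chain_step ih st.
Qed.

Lemma chain_sum_rev (R : realType) (V : normedModType R) (U : set V)
    (c : V -> V -> R) (p q : V) (a : R) :
  open U -> additive_on_balls U c ->
  chain_sum U c p q a -> chain_sum U c q p (- a).
Proof.
move=> oU ca; elim=> {q a} [|q s a _ ih qs].
  by rewrite oppr0; exact: chain_nil.
rewrite opprD addrC -(additive_on_balls_sym oU ca qs).
apply: chain_sum_cat ih.
rewrite -[c s q]add0r; apply: chain_step; first exact: chain_nil.
exact: close_in_sym.
Qed.

Lemma chain_sum_seq (R : realType) (V : normedModType R) (U : set V)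
    (c : V -> V -> R) (p q : V) (a : R) :
  chain_sum U c p q a -> exists (x : nat -> V) (k : nat),
    [/\ x 0 = p, x k = q, forall i, (i < k)%N -> close_in U (x i) (x i.+1) &
        a = \sum_(0 <= i < k) c (x i) (x i.+1)].
Proof.
elim=> {q a} [|q s a _ [x [k [x0 xk xc ->]]] qs].
  by exists (fun=> p), 0; split => //; rewrite big_nil.
pose y i := if (i <= k)%N then x i else s.
have yx i : (i <= k)%N -> y i = x i by rewrite /y => ->.
have yk : y k.+1 = s by rewrite /y ltnn.
exists y, k.+1; split => //.
- move=> i; rewrite ltnS leq_eqVlt => /predU1P[->|ik].
    by rewrite yk yx// xk.
  by rewrite !yx//; [exact: xc|exact: ltnW].
- rewrite big_nat_recr//= yk yx// xk; congr (_ + _).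
  by apply: eq_big_nat => i /andP[_ ik]; rewrite !yx// ltnW.
Qed.

Lemma chain_sum_of_seq (R : realType) (V : normedModType R) (U : set V)
    (c : V -> V -> R) (x : nat -> V) (k : nat) :
  (forall i, (i < k)%N -> close_in U (x i) (x i.+1)) ->
  chain_sum U c (x 0) (x k) (\sum_(0 <= i < k) c (x i) (x i.+1)).
Proof.
elim: k => [_|k ih xc]; first by rewrite big_nil; exact: chain_nil.
rewrite big_nat_recr//=; apply: chain_step (xc k _) => //.
by apply: ih => i ik; apply: xc; exact: ltnW.
Qed.

(** Discrete Stokes on an N by N grid.  In each cell the two ways from one
    corner to the opposite one have the same sum, so the difference of two
    consecutive rows telescopes to the difference of the two lateral edges. *)
Lemma grid_row_sum (R : realType) (V : normedModType R) (U : set V)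
    (c : V -> V -> R) (a : nat -> nat -> V) (N : nat) :
  additive_on_balls U c ->
  (forall i k, (i < N)%N -> (k < N)%N -> exists b r, [/\ ball b r `<=` U,
     ball b r (a i k), ball b r (a i.+1 k),
     ball b r (a i k.+1) & ball b r (a i.+1 k.+1)]) ->
  (forall k, (k < N)%N -> c (a 0 k) (a 0 k.+1) = c (a N k) (a N k.+1)) ->
  \sum_(0 <= i < N) c (a i 0) (a i.+1 0) =
  \sum_(0 <= i < N) c (a i N) (a i.+1 N).
Proof.
move=> ca cell side.
suff row k : (k <= N)%N -> \sum_(0 <= i < N) c (a i 0) (a i.+1 0) =
    \sum_(0 <= i < N) c (a i k) (a i.+1 k) by exact: row.
elim: k => // k ih kN; rewrite (ih (ltnW kN)); apply/eqP; rewrite -subr_eq0.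
rewrite -sumrB (telescope_sumr_eq (fun i => - c (a i k) (a i k.+1)))//.
  by rewrite side// subrr.
move=> i /andP[_ iN]; have [b [r [bU b1 b2 b3 b4]]] := cell i k iN kN.
have := ca _ _ bU _ _ _ b1 b2 b4; have := ca _ _ bU _ _ _ b1 b3 b4; lra.
Qed.

(** * Polygons *)

Definition clamp (R : realType) (t : R) : R := Num.max 0 (Num.min 1 t).

Lemma continuous_clamp (R : realType) : continuous (@clamp R).
Proof.
move=> t; apply: (@continuous_max R _ (cst 0)); first exact: cvg_cst.
by apply: (@continuous_min R _ (cst 1)) => //; exact: cvg_cst.
Qed.

(** The polygon through [x 0], ..., [x k], run at unit time per edge: the
    [l]-th summand is switched on during the time interval [[l, l + 1]].  As a
    finite sum it is continuous with no gluing of pieces. *)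
Definition polyline (R : realType) (V : normedModType R) (x : nat -> V)
    (k : nat) (t : R) : V :=
  x 0 + \sum_(0 <= l < k) clamp (t - l%:R) *: (x l.+1 - x l).

Lemma polylineE (R : realType) (V : normedModType R) (x : nat -> V)
    (k i : nat) (u : R) : (i < k)%N -> 0 <= u <= 1 ->
  polyline x k (i%:R + u) = x i + u *: (x i.+1 - x i).
Proof.
move=> ik /andP[u0 u1].
rewrite /polyline (big_cat_nat (n:=i))//=; last exact: ltnW.
rewrite (big_ltn ik) [LHS]addrA; congr (_ + _); last first.
  rewrite (_ : clamp _ = u); last first.
    by rewrite addrC addKr /clamp minEle maxEle; case: ifP; case: ifP; lra.
  rewrite [X in _ + X]big_nat big1 ?addr0// => l /andP[il _].
  rewrite (_ : clamp _ = 0) ?scale0r//.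
  have : i.+1%:R <= l%:R :> R by rewrite ler_nat.
  rewrite -natr1 /clamp minEle maxEle => h; case: ifP; case: ifP; lra.
rewrite (eq_big_nat _ _ (F2 := fun l => x l.+1 - x l)).
  by rewrite telescope_sumr// addrC subrK.
move=> l /andP[_ li]; rewrite (_ : clamp _ = 1) ?scale1r//.
have : l.+1%:R <= i%:R :> R by rewrite ler_nat.
rewrite -natr1 /clamp minEle maxEle => h; case: ifP; case: ifP; lra.
Qed.

Lemma continuous_polyline (R : realType) (V : normedModType R) (x : nat -> V)
    (k : nat) : continuous (polyline x k).
Proof.
move=> t; apply: cvgD; first exact: cvg_cst.
apply: cvg_big => [|l _]; first exact: add_continuous.
apply: cvgZr_tmp.
apply: continuous_cvg; first exact: continuous_clamp.
by apply: cvgB => //; exact: cvg_cst.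
Qed.

Lemma ball_segment (R : realType) (V : normedModType R) (a p q : V) (r u : R) :
  ball a r p -> ball a r q -> 0 <= u <= 1 -> ball a r (p + u *: (q - p)).
Proof.
rewrite -!ball_normE /= => ap aq /andP[u0 u1].
have -> : a - (p + u *: (q - p)) = (1 - u) *: (a - p) + u *: (a - q).
  rewrite scalerBl scale1r -addrA -scalerN -scalerDr opprB addrA subrK.
  by rewrite opprD addrA -scalerN opprB.
apply: le_lt_trans (ler_normD _ _) _.
rewrite !normrZ (ger0_norm u0) ger0_norm ?subr_ge0//.
have /= : Num.max `|a - p| `|a - q| < r by rewrite gt_max ap aq.
have : `|a - p| <= Num.max `|a - p| `|a - q| by rewrite le_max lexx.
have : `|a - q| <= Num.max `|a - p| `|a - q| by rewrite le_max lexx orbT.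
by nra.
Qed.

Lemma nat_floor (R : realType) (k : nat) (t : R) : (0 < k)%N ->
  0 <= t <= k%:R -> exists i u, [/\ (i < k)%N, 0 <= u <= 1 & t = i%:R + u].
Proof.
case: k => // k _; elim: k t => [|k ih] t /andP[t0 tk].
  by exists 0, t; rewrite t0 tk add0r.
have [/(conj t0)/andP/ih[i [u [ik ? ?]]]|kt] := leP t k.+1%:R.
  by exists i, u; split => //; exact: ltnW.
exists k.+1, (t - k.+1%:R); split => //; last by rewrite addrC subrK.
by move: tk; rewrite -[in X in X -> _]natr1; lra.
Qed.

Lemma polyline_in (R : realType) (V : normedModType R) (U : set V)
    (x : nat -> V) (k : nat) (t : R) : (0 < k)%N ->
  (forall i, (i < k)%N -> close_in U (x i) (x i.+1)) ->
  0 <= t <= k%:R -> U (polyline x k t).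
Proof.
move=> k0 xc /(nat_floor k0)[i [u [ik u01 ->]]]; rewrite polylineE//.
by have [a [r [bU bi bi1]]] := xc _ ik; apply: bU; exact: ball_segment.
Qed.

(** Subdividing each edge into [M] parts does not change the sum of [c], since
    [c] is additive on the ball that contains the edge. *)
Lemma polyline_sum (R : realType) (V : normedModType R) (U : set V)
    (c : V -> V -> R) (x : nat -> V) (k M : nat) :
  open U -> additive_on_balls U c -> (0 < M)%N ->
  (forall i, (i < k)%N -> close_in U (x i) (x i.+1)) ->
  \sum_(0 <= j < k * M)
     c (polyline x k (j%:R / M%:R)) (polyline x k (j.+1%:R / M%:R)) =
  \sum_(0 <= i < k) c (x i) (x i.+1).
Proof.
move=> oU ca M0 xc; rewrite big_nat_mul; apply: eq_big_nat => i /andP[_ ik].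
pose y j := polyline x k (j%:R / M%:R).
have [a [r [bU bi bi1]]] := xc _ ik.
have M0' : (0:R) < M%:R by rewrite ltr0n.
have yE l : (l <= M)%N ->
    y (i * M + l)%N = x i + (l%:R / M%:R) *: (x i.+1 - x i).
  move=> lM; rewrite /y natrD natrM mulrDl mulfK ?gt_eqF//.
  by rewrite polylineE// divr_ge0//= ler_pdivrMr// mul1r ler_nat.
have by_ j : (i * M <= j <= i.+1 * M)%N -> ball a r (y j).
  move=> /andP[ij ji]; have lM : (j - i * M <= M)%N.
    by rewrite leq_subLR addnC -mulSn.
  rewrite -(subnKC ij) yE//; apply: ball_segment => //.
  by rewrite divr_ge0//= ler_pdivrMr// mul1r ler_nat.
rewrite (telescope_sumr_eq (fun j => c (x i) (y j))).
- rewrite mulSnr yE// divff ?gt_eqF// scale1r [x i + _]addrC subrK.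
  rewrite -[X in _ - c _ (y X)]addn0 yE// mul0r scale0r addr0.
  by rewrite (additive_on_balls_refl oU ca (bU _ bi)) subr0.
- by rewrite mulSnr leq_addr.
- move=> j /andP[ij ji].
  have b1 : ball a r (y j) by apply: by_; rewrite ij ltnW.
  have b2 : ball a r (y j.+1) by apply: by_; rewrite leqW.
  by have := ca _ _ bU _ _ _ bi b1 b2; rewrite -/(y j) -/(y j.+1); lra.
Qed.

(** * Simply connected sets: a potential from a locally additive function *)

(** Contract the polygon [g] through the chain by a homotopy [H], and lay a grid
    of [N = k * M] steps on its square: a multiple of [k], so that the vertices
    of the polygon are grid points, and with mesh below the Lebesgue number.
    The first row then has the sum of the chain, the last row is constant,
    and [grid_row_sum] identifies the two. *)
Lemma closed_chain_sum (R : realType) (V : normedModType R) (U : set V)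
    (c : V -> V -> R) (p : V) (a : R) :
  open U -> simply_connected U -> additive_on_balls U c ->
  chain_sum U c p p a -> a = 0.
Proof.
move=> oU [_ sc] ca /chain_sum_seq[x [k [x0 xk xc ->]]].
have [->|k0] := posnP k; first by rewrite big_nil.
have k0' : (0:R) < k%:R by rewrite ltr0n.
pose g (s : R) := polyline x k (k%:R * s).
have pE i : (i <= k)%N -> polyline x k (i%:R : R) = x i.
  rewrite leq_eqVlt => /predU1P[->|ik].
    rewrite -(prednK k0) -natr1 polylineE ?prednK// ?lexx ?ler01//.
    by rewrite scale1r addrC subrK.
  by rewrite -[i%:R]addr0 polylineE ?lexx ?ler01// scale0r addr0.
have g0 : g 0 = p by rewrite /g mulr0 -x0 -(pE 0%N).
have g1 : g 1 = p by rewrite /g mulr1 pE.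
have cg : {within `[0, 1], continuous g}.
  apply: continuous_subspaceT => s.
  apply: continuous_cvg; first exact: continuous_polyline.
  by apply: cvgM => //; exact: cvg_cst.
have Ug s : s \in `[0, 1] -> U (g s).
  rewrite in_itv/= => /andP[s0 s1]; apply: polyline_in => //.
  by rewrite mulr_ge0//= -[leRHS]mulr1 ler_pM2l.
have [H [cH HU H0 H1 Hs]] := sc g cg Ug (etrans g0 (esym g1)).
have cK : compact (`[0, 1]%classic `*` `[0, 1]%classic : set (R * R)).
  by apply: compact_setX; exact: segment_compact.
have [[z1 z2] [/= ? ?]|e e0 He] := lebesgue_number oU cK cH.
  exact: HU.
have [M M0 Me] : exists2 M : nat, (0 < M)%N & M%:R^-1 < e.
  have [M _ HM] := near_infty_natSinv_lt (PosNum e0).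
  by exists M.+1 => //; exact: (HM M (leqnn M)).
pose N := (k * M)%N.
have N0 : (0 < N)%N by rewrite muln_gt0 k0.
have N0' : (0:R) < N%:R by rewrite ltr0n.
have NE i : k%:R * (i%:R / N%:R) = i%:R / M%:R :> R.
  by rewrite natrM invfM mulrCA mulVKf// gt_eqF.
have in01 i : (i <= N)%N -> i%:R / N%:R \in `[0, 1 : R].
  by move=> iN; rewrite in_itv/= divr_ge0//= ler_pdivrMr// mul1r ler_nat.
have st i : `|i%:R / N%:R - i.+1%:R / N%:R| < e :> R.
  rewrite -mulrBl -natr1 opprD addNKr mulN1r normrN gtr0_norm ?invr_gt0//.
  apply: le_lt_trans Me; rewrite lef_pV2 ?posrE ?ltr0n// ler_nat.
  by rewrite leq_pmull.
have cell i j : (i < N)%N -> (j < N)%N ->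
    exists b r, [/\ ball b r `<=` U,
     ball b r (H (i%:R / N%:R, j%:R / N%:R)),
     ball b r (H (i.+1%:R / N%:R, j%:R / N%:R)),
     ball b r (H (i%:R / N%:R, j.+1%:R / N%:R)) &
     ball b r (H (i.+1%:R / N%:R, j.+1%:R / N%:R))].
  move=> iN jN.
  have [|b [r [bU br]]] := He (i%:R / N%:R, j%:R / N%:R).
    by split => /=; apply: in01; exact: ltnW.
  exists b, r; split => //; apply: br; split => /=;
    by [exact: in01 | apply: in01; exact: ltnW | exact: ballxx
      | rewrite -ball_normE; exact: st].
have := grid_row_sum ca cell.
rewrite mul0r divff ?gt_eqF// => rows.
rewrite -(polyline_sum oU ca M0 xc).
transitivity (\sum_(0 <= i < N)
    c (H (i%:R / N%:R, 0)) (H (i.+1%:R / N%:R, 0))).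
  apply: eq_big_nat => i /andP[_ iN].
  by rewrite !H0 ?in01// 1?ltnW// /g !NE.
rewrite rows.
  apply: big1_seq => i /andP[_]; rewrite mem_index_iota => /andP[_ iN].
  rewrite !H1 ?in01// 1?ltnW// g0.
  apply: (additive_on_balls_refl oU ca); rewrite -g0; apply: Ug.
  by rewrite in_itv/= lexx ler01.
move=> j jN.
by have [-> ->] := Hs _ (in01 _ (ltnW jN)); have [-> ->] := Hs _ (in01 _ jN).
Qed.

Lemma chain_sum_exists (R : realType) (V : normedModType R) (U : set V)
    (c : V -> V -> R) (p q : V) :
  open U -> path_connected U -> U p -> U q -> exists a, chain_sum U c p q a.
Proof.
move=> oU pc Up Uq; have [g [cg gU <- <-]] := pc p q Up Uq.
have [z z01|e e0 He] := lebesgue_number oU (@segment_compact _ _ _) cg.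
  exact: gU.
have [M _ HM] := near_infty_natSinv_lt (PosNum e0).
have Me : M.+1%:R^-1 < e by exact: (HM M (leqnn M)).
have M0 : (0:R) < M.+1%:R by rewrite ltr0n.
have in01 i : (i <= M.+1)%N -> i%:R / M.+1%:R \in `[0, 1 : R].
  by move=> iN; rewrite in_itv/= divr_ge0//= ler_pdivrMr// mul1r ler_nat.
have := @chain_sum_of_seq _ _ U c (fun i => g (i%:R / M.+1%:R)) M.+1.
rewrite mul0r divff ?gt_eqF// => h; eexists; apply: h => i iM.
have [|a [r [bU br]]] := He (i%:R / M.+1%:R); first by apply: in01; exact: ltnW.
exists a, r; split => //; apply: br.
- by apply: in01; exact: ltnW.
- exact: ballxx.
- exact: in01.
- rewrite -ball_normE/= -mulrBl -[in X in _ - X]natr1 opprD addNKr mulN1r.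
  by rewrite normrN gtr0_norm ?invr_gt0.
Qed.

(** The potential is the sum along any chain from a base point: two chains to
    the same point form a closed chain, and appending the step from [p] to [q]
    adds [c p q]. *)
Lemma additive_on_balls_potential (R : realType) (V : normedModType R)
    (U : set V) (c : V -> V -> R) :
  open U -> simply_connected U -> additive_on_balls U c ->
  exists G : V -> R, forall p q, close_in U p q -> G q - G p = c p q.
Proof.
move=> oU sc ca.
have [[p0 Up0]|U0] := pselect (U !=set0); last first.
  exists (fun=> 0) => p q [a [r [bU bp _]]].
  by case: U0; exists p; exact: bU.
have /choice[G HG] : forall p, exists a, U p -> chain_sum U c p0 p a.
  move=> p; have [Up|nUp] := pselect (U p); last by exists 0.
  by have [a ?] := chain_sum_exists c oU sc.1 Up0 Up; exists a.
exists G => p q pq; have [a [r [bU bp bq]]] := pq.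
have step := chain_step (HG p (bU _ bp)) pq.
have := chain_sum_cat step (chain_sum_rev oU ca (HG q (bU _ bq))).
by move=> /(closed_chain_sum oU sc ca); lra.
Qed.

(** * Calculus of 1-forms *)

Definition integral01 (R : realType) (f : R -> R) : R :=
  \int[lebesgue_measure]_(s in `[0, 1]) f s.

Lemma integrable01 (R : realType) (f : R -> R) :
  {within `[0, 1], continuous f} ->
  lebesgue_measure.-integrable `[0, 1] (EFin \o f).
Proof.
move=> cf; apply: continuous_compact_integrable => //.
exact: segment_compact.
Qed.

Lemma integral01_FTC (R : realType) (f F : R -> R) :
  {within `[0, 1], continuous f} ->
  (forall s : R, s \in `[0, 1] -> is_derive s 1 F (f s)) ->
  integral01 f = F 1 - F 0.
Proof.
move=> cf dF; rewrite /integral01 /Rintegral.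
have cF s : s \in `[0, 1] -> {for s, continuous F}.
  move=> /dF[dFs _]; apply: differentiable_continuous.
  exact/derivable1_diffP.
rewrite (@continuous_FTC2 _ f F)//.
- split.
  + by move=> s /subset_itv_oo_cc /dF[].
  + by apply: cvg_at_right_filter; apply: cF; rewrite in_itv/= lexx ler01.
  + by apply: cvg_at_left_filter; apply: cF; rewrite in_itv/= lexx ler01.
- by move=> s /subset_itv_oo_cc /dF[_ <-]; rewrite derive1E.
Qed.

Lemma integral01_dist (R : realType) (f : R -> R) (K M : R) :
  {within `[0, 1], continuous f} ->
  (forall s : R, s \in `[0, 1] -> `|f s - K| <= M) -> `|integral01 f - K| <= M.
Proof.
move=> cf fM.
have cstI (a : R) : lebesgue_measure.-integrable `[0, 1] (EFin \o (fun=> a)).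
  by apply: integrable01; apply: continuous_subspaceT => ?; exact: cvg_cst.
have cstE (a : R) : integral01 (fun=> a) = a.
  rewrite /integral01 Rintegral_cst// [X in fine X](_ : _ = 1%:E) ?mulr1//.
  apply: etrans (lebesgue_measure_itv `[0, 1 : R]) _.
  by rewrite /= lte_fin ltr01 -EFinD subr0.
have intf := integrable01 cf.
have bnd s : s \in `[0, 1] -> K - M <= f s <= K + M.
  by move=> /fM; rewrite ler_norml; lra.
rewrite ler_norml lerBrDr lerBlDr; apply/andP; split.
  rewrite addrC -[leLHS]cstE /integral01; apply: le_Rintegral => //.
  by move=> s s01; have /andP[] := bnd s s01.
rewrite addrC -[leRHS]cstE /integral01; apply: le_Rintegral => //.
by move=> s s01; have /andP[] := bnd s s01.
Qed.

Lemma is_derive_line (R : realType) (V W : normedModType R) (F : V -> W)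
    (a u : V) (h : R) : derivable F (a + h *: u) u ->
  is_derive h 1 (fun k => F (a + k *: u)) ('D_u F (a + h *: u)).
Proof.
have E : (fun k : R => k^-1 *: (((fun k => F (a + k *: u)) \o shift h) (k *: 1)
     - F (a + h *: u))) =
   (fun k : R => k^-1 *: ((F \o shift (a + h *: u)) (k *: u)
     - F (a + h *: u))).
  apply/funext => k /=; congr (_ *: (F _ - _)).
  by rewrite scaler1 scalerDl addrCA addrC.
by move=> dF; split; rewrite /derivable /derive E.
Qed.

(** Turns the little-o in the definition of the differential into an
    epsilon-estimate. *)
Lemma is_diff_of_norm (R : realType) (V : normedModType R) (f : V -> R)
    (df : {linear V -> R}) (x : V) : continuous df ->
  (forall e : R, 0 < e ->
     \forall v \near (0:V), `|f (v + x) - f x - df v| <= e * `|v|) ->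
  is_diff x f df.
Proof.
move=> cdf fx.
have o : f \o shift x = cst (f x) + df +o_ (0:V) id.
  apply/eqaddoP => e e0; near=> v.
  rewrite (_ : (_ - _) v = f (v + x) - f x - df v); last first.
    by rewrite /= opprD addrA.
  by near: v; exact: fx.
have dE := diff_unique cdf o.
by apply: DiffDef => //; apply/diff_locallyP; rewrite dE; split.
Unshelve. all: by end_near.
Qed.

Definition form (R : realType) (m : nat) (omega : 'I_m -> 'cV[R]_m -> R)
    (t v : 'cV[R]_m) : R := \sum_(j < m) omega j t * v j 0.

Lemma form_is_linear (R : realType) (m : nat)
  (omega : 'I_m -> 'cV[R]_m -> R) (t : 'cV[R]_m) : linear (form omega t).
Proof.
move=> a u v; rewrite /form scaler_sumr -big_split /=; apply: eq_bigr => j _.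
by rewrite !mxE mulrDr mulrCA.
Qed.

HB.instance Definition _ (R : realType) (m : nat)
    (omega : 'I_m -> 'cV[R]_m -> R) (t : 'cV[R]_m) :=
  GRing.isLinear.Build R 'cV[R]_m R *:%R (form omega t)
    (@form_is_linear R m omega t).

Lemma continuous_form (R : realType) (m : nat) (X : topologicalType)
    (omega : 'I_m -> 'cV[R]_m -> R) (f g : X -> 'cV[R]_m) (x : X) :
  (forall j, {for f x, continuous (omega j)}) ->
  {for x, continuous f} -> {for x, continuous g} ->
  {for x, continuous (fun y => form omega (f y) (g y))}.
Proof.
move=> co cf cg.
apply: cvg_big => [|j _]; first exact: add_continuous.
apply: cvgM; first exact: (@continuous_comp _ _ _ f (omega j)).
apply: (@continuous_comp _ _ _ g (fun v : 'cV[R]_m => v j 0) x) => //.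
exact: coord_continuous.
Qed.

Lemma coord_le_norm (R : realType) (m : nat) (v : 'cV[R]_m) (j : 'I_m) :
  `|v j 0| <= `|v|.
Proof.
rewrite [leRHS]mx_normrE.
exact: (le_bigmax 0 (fun ij : 'I_m * 'I_1 => `|v ij.1 ij.2|) (j, 0)).
Qed.

Lemma derive_coords (R : realType) (m : nat) (W : normedModType R)
    (F : 'cV[R]_m -> W) (t v : 'cV[R]_m) :
  differentiable F t ->
  'D_v F t = \sum_(j < m) v j 0 *: 'D_(delta_mx j 0) F t.
Proof.
move=> dF; rewrite deriveE// [in LHS](matrix_sum_delta v) linear_sum.
apply: eq_bigr => j _; rewrite big_ord1 linearZ; congr (_ *: _).
by rewrite deriveE.
Qed.

(** Closedness in terms of arbitrary directions: the bilinear form of the first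
    derivatives of [omega] at [t] is symmetric. *)
Lemma closed_form_sym (R : realType) (m : nat)
    (omega : 'I_m -> 'cV[R]_m -> R) (t v w : 'cV[R]_m) :
  (forall j, differentiable (omega j) t) ->
  (forall j k, 'D_(delta_mx k 0) (omega j) t = 'D_(delta_mx j 0) (omega k) t) ->
  form (fun j => 'D_v (omega j)) t w = form (fun j => 'D_w (omega j)) t v.
Proof.
move=> d cl; rewrite /form.
under eq_bigr => j _ do rewrite derive_coords// mulr_suml.
under [RHS]eq_bigr => j _ do rewrite derive_coords// mulr_suml.
rewrite exchange_big; apply: eq_bigr => j _; apply: eq_bigr => k _.
by rewrite cl /GRing.scale/= [LHS]mulrC [LHS]mulrA [LHS]mulrAC.
Qed.

(** * The local Poincare lemma *)

Section LocalPoincare.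
Variables (R : realType) (m : nat) (U : set 'cV[R]_m).
Variable omega : 'I_m -> 'cV[R]_m -> R.
Hypothesis C1omega : forall j, C1_on U (omega j).
Hypothesis closed_omega : forall t, U t -> forall j k,
  'D_(delta_mx k 0) (omega j) t = 'D_(delta_mx j 0) (omega k) t.

Definition segint (p q : 'cV[R]_m) : R :=
  integral01 (fun s => form omega (p + s *: (q - p)) (q - p)).

Let omega_cont t j : U t -> {for t, continuous (omega j)}.
Proof.
by move=> Ut; apply: differentiable_continuous; apply: (C1omega j).1.
Qed.

Lemma is_derive_moving_segment (p w v : 'cV[R]_m) (h s : R) :
  U (p + s *: (w + h *: v)) ->
  is_derive h 1 (fun h => form omega (p + s *: (w + h *: v)) (w + h *: v))
    (s * form (fun j => 'D_v (omega j)) (p + s *: (w + h *: v)) (w + h *: v)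
     + form omega (p + s *: (w + h *: v)) v).
Proof.
move=> Ut; set t := p + _ in Ut *.
have tE k : p + s *: (w + k *: v) = (p + s *: w) + k *: (s *: v).
  by rewrite scalerDr addrA !scalerA mulrC.
have domega j : is_derive h 1 (fun k => omega j (p + s *: (w + k *: v)))
    (s * 'D_v (omega j) t).
  have d := (C1omega j).1 _ Ut.
  have -> : s * 'D_v (omega j) t = 'D_(s *: v) (omega j) t.
    by rewrite !deriveE// linearZ.
  rewrite /t; under eq_fun do rewrite tE; rewrite tE.
  by apply: is_derive_line; apply: diff_derivable; rewrite -tE.
have dcoord j : is_derive h 1 (fun k => (w + k *: v) j 0) (v j 0).
  rewrite (_ : (fun k : R => _) = cst (w j 0) + (v j 0 *: id)); last first.
    by apply/funext => k; rewrite !fctE/= !mxE mulrC.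
  by apply: is_derive_eq; rewrite add0r; exact: mulr1.
rewrite (_ : (fun h => form _ _ _) = \sum_(j < m)
  ((fun k => omega j (p + s *: (w + k *: v))) *
   (fun k => (w + k *: v) j 0))); last first.
  by apply/funext => k; rewrite fct_sumE.
apply: is_derive_eq.
rewrite /form mulr_sumr -big_split /=; apply: eq_bigr => j _.
rewrite addrC /GRing.scale/= -/t; congr (_ + _).
by rewrite mulrC mulrA.
Qed.

Lemma is_derive_form_line (p w v : 'cV[R]_m) (s : R) : U (p + s *: w) ->
  is_derive s 1 (fun s => form omega (p + s *: w) v)
    (form (fun j => 'D_w (omega j)) (p + s *: w) v).
Proof.
move=> Ut.
have d j : is_derive s 1 (fun s => omega j (p + s *: w))
    ('D_w (omega j) (p + s *: w)).
  by apply: is_derive_line; apply: diff_derivable; exact: (C1omega j).1.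
rewrite (_ : (fun s => form _ _ _) = \sum_(j < m)
    (v j 0 *: (fun s => omega j (p + s *: w)))); last first.
  apply/funext => k; rewrite fct_sumE; apply: eq_bigr => j _.
  by rewrite !fctE mulrC.
apply: is_derive_eq; apply: eq_bigr => j _.
by rewrite /GRing.scale/= mulrC.
Qed.

(* [dmoving] is the derivative in [x.1] of the integrand [form omega] on the
   segment from [p] to [p + w + x.1 *: v], at the parameter [x.2]; joint
   continuity provides the bound that differentiation under the integral sign
   requires. *)
Let moving (p w v : 'cV[R]_m) (x : R * R) : 'cV[R]_m :=
  p + x.2 *: (w + x.1 *: v).

Let dmoving (p w v : 'cV[R]_m) (x : R * R) : R :=
  x.2 * form (fun j => 'D_v (omega j)) (moving p w v x) (w + x.1 *: v)
  + form omega (moving p w v x) v.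

Let velocity_cont (w v : 'cV[R]_m) (x : R * R) :
  {for x, continuous (fun x : R * R => w + x.1 *: v)}.
Proof.
by apply: cvgD; [exact: cvg_cst|apply: cvgZr_tmp; exact: cvg_fst].
Qed.

Let moving_cont (p w v : 'cV[R]_m) (x : R * R) :
  {for x, continuous (moving p w v)}.
Proof.
apply: cvgD; first exact: cvg_cst.
by apply: cvgZ; [exact: cvg_snd|exact: velocity_cont].
Qed.

Let dmoving_cont (p w v : 'cV[R]_m) (x : R * R) : U (moving p w v x) ->
  {for x, continuous (dmoving p w v)}.
Proof.
move=> Ux; apply: cvgD.
  apply: cvgM; first exact: cvg_snd.
  apply: continuous_form; [|exact: moving_cont|exact: velocity_cont].
  by move=> j; exact: (C1omega j).2.
apply: continuous_form; [|exact: moving_cont|exact: cvg_cst].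
by move=> j; exact: omega_cont.
Qed.

Let pair_cont (k s : R) : {for s, continuous (fun s : R => (k, s))}.
Proof.
by apply: (@cvg_pair _ _ _ (nbhs s) (nbhs k) (nbhs s));
  [exact: cvg_cst|exact: cvg_id].
Qed.

Let form_line_cont (p v : 'cV[R]_m) :
  (forall s : R, s \in `[0, 1] -> U (p + s *: v)) ->
  {within `[0, 1], continuous (fun s : R => form omega (p + s *: v) v)}.
Proof.
move=> Uv; apply: continuous_in_subspaceT => s; rewrite inE => s01.
apply: (@continuous_form _ _ _ omega (fun s : R => p + s *: v) (fun=> v)).
- by move=> j; apply: omega_cont; exact: Uv.
- by apply: cvgD; [exact: cvg_cst|exact: cvgZr_tmp].
- exact: cvg_cst.
Qed.

(** By closedness, [dmoving p w v (h, s)] is the derivative in [s] of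
    [s * form omega (p + s *: (w + h *: v)) v], so the integral over [s] of the
    derivative in [h] is the value of this function at [s = 1]. *)
Lemma is_derive_segint (a p q v : 'cV[R]_m) (r h : R) :
  ball a r `<=` U -> ball a r p -> ball a r (q + h *: v) ->
  is_derive h 1 (fun k => segint p (q + k *: v)) (form omega (q + h *: v) v).
Proof.
move=> bU bp bq; pose w := q - p.
have [d d0 bd] : exists2 d : R, 0 < d &
    forall k, `|h - k| <= d -> ball a r (q + k *: v).
  have : \forall k \near h, ball a r (q + k *: v).
    have c : {for h, continuous (fun k : R => q + k *: v)}.
      by apply: cvgD; [exact: cvg_cst|apply: cvgZr_tmp].
    by apply: c; apply: open_nbhs_nbhs; split; [exact: ball_open|].
  move=> /nbhs_ballP[d d0 bd]; exists (d / 2) => [|k hk].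
    by rewrite divr_gt0.
  apply: bd; rewrite -ball_normE/=; apply: le_lt_trans hk _.
  by rewrite ltr_pdivrMr// ltr_pMr// ltr1n.
have segU k s : `|h - k| <= d -> s \in `[0, 1] -> U (moving p w v (k, s)).
  move=> hk; rewrite in_itv/= => s01; apply: bU; rewrite /moving/= /w addrAC.
  by apply: ball_segment => //; exact: bd.
pose f k s := form omega (moving p w v (k, s)) (w + k *: v).
have segE k : segint p (q + k *: v) = integral01 (f k).
  by rewrite /segint /f /moving /w [q - p + _]addrAC.
have itvd k : k \in `]h - d, h + d[ -> `|h - k| <= d.
  by rewrite in_itv/= ler_norml; lra.
have df k s : `|h - k| <= d -> s \in `[0, 1] ->
    is_derive k 1 (f ^~ s) (dmoving p w v (k, s)).
  by move=> hk s01; apply: is_derive_moving_segment; exact: segU hk s01.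
have [M M0 DM] : exists2 M : R, 0 <= M & forall k s, `|h - k| <= d ->
    s \in `[0, 1] -> `|dmoving p w v (k, s)| <= M.
  pose K := (`[h - d, h + d]%classic `*` `[0, 1]%classic : set (R * R)).
  have cK : compact K by apply: compact_setX; exact: segment_compact.
  have KE k s : K (k, s) <-> `|h - k| <= d /\ s \in `[0, 1].
    by rewrite /K/= !in_itv/= ler_norml; split=> -[? ?]; split => //; lra.
  have cD : {within K, continuous (dmoving p w v)}.
    apply: continuous_in_subspaceT => -[k s]; rewrite inE => /KE[hk s01].
    by apply: dmoving_cont; exact: segU.
  have [M [_ HM]] := compact_bounded (continuous_compact cD cK).
  exists (`|M| + 1) => [|k s hk s01]; first by rewrite addr_ge0.
  apply: HM; first by rewrite (le_lt_trans (ler_norm _))// ltrDl.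
  by exists (k, s) => //; exact/KE.
have intf k : k \in `]h - d, h + d[ ->
    lebesgue_measure.-integrable `[0, 1] (EFin \o f k).
  move=> /itvd hk; apply: integrable01.
  apply: continuous_in_subspaceT => s; rewrite inE => s01.
  apply: (@continuous_form _ _ _ omega (fun s => moving p w v (k, s))
    (fun=> w + k *: v)); last exact: cvg_cst.
    by move=> j; apply: omega_cont; exact: segU.
  apply: (@continuous_comp _ _ _ (fun s : R => (k, s)) (moving p w v)).
    exact: pair_cont.
  exact: moving_cont.
have hI : `]h - d, h + d[%classic h by rewrite /= in_itv/=; lra.
have der k s : `]h - d, h + d[%classic k -> `[0, 1]%classic s ->
    derivable (f ^~ s) k 1.
  by move=> /itvd hk s01; have [] := df k s hk s01.
have bnd k s : `]h - d, h + d[%classic k -> `[0, 1]%classic s ->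
    `|partial1of2 f k s| <= cst M s.
  move=> /itvd hk s01; rewrite partial1of2E.
  by have [_ ->] := df k s hk s01; exact: DM.
have intM : lebesgue_measure.-integrable `[0, 1] (EFin \o cst M).
  by apply: integrable01; apply: continuous_subspaceT => ?; exact: cvg_cst.
have dF := derivable_under_integral (mu := @lebesgue_measure R)
  (measurable_itv _) hI intf der (fun=> M0) intM bnd.
have := differentiation_under_integral (mu := @lebesgue_measure R)
  (measurable_itv _) hI intf der (fun=> M0) intM bnd.
rewrite derive1E => DF.
under eq_fun do rewrite segE.
split; first exact: dF.
rewrite [LHS]DF.
pose u := w + h *: v.
have hd : `|h - h| <= d by rewrite subrr normr0 ltW.
have pu : p + u = q + h *: v by rewrite /u /w addrA addrCA addrA addrK.
have -> : form omega (q + h *: v) v =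
    1 * form omega (p + 1 *: u) v - 0 * form omega (p + 0 *: u) v.
  by rewrite mul1r mul0r subr0 scale1r pu.
transitivity (integral01 (fun s => dmoving p w v (h, s))).
  apply: eq_Rintegral => s; rewrite inE => s01; rewrite partial1of2E.
  by have [_ ->] := df h s hd s01.
apply: (@integral01_FTC _ _ (fun s => s * form omega (p + s *: u) v)).
- apply: continuous_in_subspaceT => s; rewrite inE => s01.
  apply: (@continuous_comp _ _ _ (fun s : R => (h, s)) (dmoving p w v)).
    exact: pair_cont.
  by apply: dmoving_cont; exact: segU.
- move=> s s01; have Us := segU h s hd s01.
  have dl := @is_derive_form_line p u v s Us.
  rewrite (_ : (fun s => _) = id * (fun s => form omega (p + s *: u) v))//.
  apply: is_derive_eq.
  rewrite /dmoving/= /moving/= -/u; congr (_ + _); last exact: mulr1.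
  congr (_ * _); apply: closed_form_sym => [j|].
    exact: (C1omega j).1.
  exact: closed_omega.
Qed.

Lemma segint_additive : additive_on_balls U segint.
Proof.
move=> a r bU p q s bp bq bs.
have bqs h : h \in `[0, 1] -> ball a r (q + h *: (s - q)).
  by rewrite in_itv/= => h01; exact: ball_segment.
rewrite [segint q s](@integral01_FTC _ _
  (fun h => segint p (q + h *: (s - q)))).
- by rewrite scale1r scale0r addr0 addrCA subrr addr0 addrC subrK.
- by apply: form_line_cont => h h01; apply: bU; exact: bqs.
- by move=> h h01; apply: is_derive_segint bU bp _; exact: bqs.
Qed.

(** For [y = t + v] close to [t], the integrand of [segint t y] differs from
    [form omega t v] by at most [e * `|v|], by continuity of [omega] at [t]. *)
Lemma is_diff_segint (G : 'cV[R]_m -> R) (t : 'cV[R]_m) : open U -> U t ->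
  (\forall y \near t, G y - G t = segint t y) -> is_diff t G (form omega t).
Proof.
move=> oU Ut Gt.
have form_cont : continuous (form omega t).
  move=> v; apply: (@continuous_form _ _ _ omega (fun=> t) id).
  - by move=> j; exact: omega_cont.
  - exact: cst_continuous.
  - exact: cvg_id.
apply: is_diff_of_norm => // e e0.
(* [m] coordinates share the error [e]; [m.+1] avoids dividing by zero. *)
pose e' := e / m.+1%:R.
have e'0 : 0 < e' by rewrite divr_gt0.
have omega_t : \forall y \near t, forall j, `|omega j y - omega j t| <= e'.
  apply: (@filter_forall _ _ (fun j y => `|omega j y - omega j t| <= e') _
    (nbhs_filter t)) => j.
  have /cvgrPdist_le/(_ _ e'0) := @omega_cont t j Ut.
  by apply: filterS => y; rewrite distrC.
have Ut' : \forall y \near t, U y by exact: open_nbhs_nbhs.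
have /nbhs_ballP[d d0 bd] : \forall y \near t, [/\ G y - G t = segint t y, U y &
    forall j, `|omega j y - omega j t| <= e'].
  by near=> y; split; near: y.
apply/nbhs_ballP; exists d => //= v; rewrite -ball_normE/= sub0r normrN => vd.
have [-> _ _] : [/\ G (v + t) - G t = segint t (v + t), U (v + t) &
    forall j, `|omega j (v + t) - omega j t| <= e'].
  by apply: bd; rewrite -ball_normE/= opprD addrCA subrr addr0 normrN.
rewrite /segint addrK.
have bs s : s \in `[0, 1] -> ball t d (t + s *: v).
  rewrite in_itv/= => /andP[s0 s1].
  rewrite -ball_normE/= opprD addNKr normrN normrZ ger0_norm//.
  by apply: le_lt_trans vd; rewrite ler_piMl.
apply: integral01_dist.
  by apply: form_line_cont => s s01; have [] := bd _ (bs _ s01).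
move=> s s01; rewrite -sumrB.
apply: le_trans (ler_norm_sum _ _ _) _.
apply: (@le_trans _ _ (\sum_(j < m) e' * `|v|)).
  apply: ler_sum => j _; rewrite -mulrBl normrM.
  by apply: ler_pM => //; [have [] := bd _ (bs _ s01)|exact: coord_le_norm].
rewrite sumr_const card_ord -[leLHS]mulr_natr mulrAC ler_wpM2r//.
by rewrite /e' mulrAC ler_pdivrMr// ler_pM2l// ler_nat.
Unshelve. all: by end_near.
Qed.
End LocalPoincare.

Lemma closed_form_primitive (R : realType) (m : nat) (U : set 'cV[R]_m)
    (omega : 'I_m -> 'cV[R]_m -> R) :
  open U -> simply_connected U -> (forall j, C1_on U (omega j)) ->
  (forall t, U t -> forall j k,
    'D_(delta_mx k 0) (omega j) t = 'D_(delta_mx j 0) (omega k) t) ->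
  exists G, primitive_on U omega G.
Proof.
move=> oU sc C1 cl.
have [G HG] := additive_on_balls_potential oU sc (segint_additive C1 cl).
exists G => t Ut.
have [d d0 bd] := (nbhs_ballP _ _).1 (open_nbhs_nbhs (conj oU Ut)).
apply: is_diff_segint => //.
apply/nbhs_ballP; exists d => // y ty; apply: HG.
by exists t, d; split => //; exact: ballxx.
Qed.

(** * The integrating factor phi *)

Lemma continuous_near_eq (X Y : topologicalType) (f g : X -> Y) (p : X) :
  (\forall q \near p, g q = f q) ->
  {for p, continuous g} -> {for p, continuous f}.
Proof.
move=> gf cg; have gfp : g p = f p := nbhs_singleton gf.
have : f @ p --> g p by apply: cvg_trans cg; exact: near_eq_cvg.
by rewrite gfp.
Qed.

Lemma is_diff_linear (R : realType) (V W : normedModType R)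
    (f : {linear V -> W}) (x : V) : continuous f -> is_diff x f f.
Proof.
by move=> cf; apply: DiffDef; [exact: linear_differentiable|exact: diff_lin].
Qed.

Lemma is_diff_fst (R : realType) (V W : normedModType R) (p : V * W) :
  is_diff p fst fst.
Proof. by apply: (@is_diff_linear _ _ _ fst) => q; exact: cvg_fst. Qed.

Lemma is_diff_snd (R : realType) (V W : normedModType R) (p : V * W) :
  is_diff p snd snd.
Proof. by apply: (@is_diff_linear _ _ _ snd) => q; exact: cvg_snd. Qed.

(** Makes the lemmas on 1-forms and linear maps available for [dotv u]. *)
Lemma dotv_form (R : realType) (n : nat) (u : 'cV[R]_n) :
  dotv u = form (fun i _ => u i 0) 0.
Proof. by []. Qed.

Lemma continuous_dotv (R : realType) (n : nat) (u : 'cV[R]_n) :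
  continuous (dotv u).
Proof.
move=> x; rewrite dotv_form.
apply: (@continuous_form _ _ _ (fun i _ => u i 0) (fun=> 0) id).
- by move=> i; exact: cst_continuous.
- exact: cst_continuous.
- exact: cvg_id.
Qed.

Lemma is_diff_dotv (R : realType) (n : nat) (u x : 'cV[R]_n) :
  is_diff x (dotv u) (dotv u).
Proof.
apply: (@is_diff_linear _ _ _ (form (fun i _ => u i 0) 0)).
exact: continuous_dotv.
Qed.

Lemma dotvE (R : realType) (n : nat) (u x : 'cV[R]_n) :
  dotv u x = (u^T *m x) 0 0.
Proof. by rewrite mxE; apply: eq_bigr => i _; rewrite mxE. Qed.

Lemma dotv_trmul (R : realType) (n : nat) (A : 'M[R]_n) (u x : 'cV[R]_n) :
  dotv u (A^T *m x) = dotv (A *m u) x.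
Proof. by rewrite !dotvE trmx_mul mulmxA. Qed.

Lemma is_diff_expR (R : realType) (x : R) :
  is_diff x expR (fun h => h * expR x).
Proof.
have d : differentiable (@expR R) x.
  by apply/derivable1_diffP; exact: derivable_expR.
by apply: DiffDef => //; rewrite diff1E// derive1E derive_val.
Qed.

Lemma phiE (R : realType) (m : nat) (lambda : 'I_m -> R) :
  phi lambda = expR \o (- dotv (\col_j lambda j)).
Proof.
apply/funext => t; rewrite /phi /= /dotv; congr expR; congr (- _).
by apply: eq_bigr => j _; rewrite mxE.
Qed.

Lemma is_diff_phi (R : realType) (m : nat) (lambda : 'I_m -> R)
    (t : 'cV[R]_m) :
  is_diff t (phi lambda) (fun v => - dotv (\col_j lambda j) v * phi lambda t).
Proof.
rewrite phiE; apply: is_diff_eq (is_diff_comp _ _) _.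
- apply: is_diffN; exact: is_diff_dotv.
- exact: is_diff_expR.
- by [].
Qed.

Lemma continuous_fun_mul (R : realType) (X : topologicalType) (f g : X -> R)
    (x : X) : {for x, continuous f} -> {for x, continuous g} ->
  {for x, continuous (fun y => f y * g y)}.
Proof. exact: cvgM. Qed.

Lemma continuous_fun_sub (R : realType) (X : topologicalType) (f g : X -> R)
    (x : X) : {for x, continuous f} -> {for x, continuous g} ->
  {for x, continuous (fun y => f y - g y)}.
Proof. exact: cvgB. Qed.

Lemma derive_is_diff (R : realType) (V W : normedModType R)
    (f df : V -> W) (x v : V) : is_diff x f df -> 'D_v f x = df v.
Proof. by move=> d; rewrite deriveE// diff_val. Qed.

(** Maps [g] and [h] on a common space cover both uses: [omega j], with
    [g = f j] on the space of [t], and [nu x * phi t], with the two projections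
    on the space of pairs [(t, x)]. *)
Lemma is_diff_dotv_phi (R : realType) (m n : nat) (V : normedModType R)
    (lambda : 'I_m -> R) (nu : 'cV[R]_n) (g : V -> 'cV[R]_n)
    (h : V -> 'cV[R]_m) (dg : V -> 'cV[R]_n) (dh : V -> 'cV[R]_m) (p : V) :
  is_diff p g dg -> is_diff p h dh ->
  is_diff p (fun q => dotv nu (g q) * phi lambda (h q))
    (fun v => phi lambda (h p) *
      (dotv nu (dg v) - dotv nu (g p) * dotv (\col_j lambda j) (dh v))).
Proof.
move=> dgp dhp.
have d1 : is_diff p (dotv nu \o g) (dotv nu \o dg).
  exact: is_diff_comp dgp (is_diff_dotv nu (g p)).
have d2 := is_diff_comp dhp (is_diff_phi lambda (h p)).
apply: is_diff_eq (is_diffM d1 d2) _.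
apply/funext => v; rewrite /= !fctE /= /GRing.scale/=; ring.
Qed.

Lemma continuous_phi (R : realType) (m : nat) (lambda : 'I_m -> R) :
  continuous (phi lambda).
Proof.
by move=> t; apply: differentiable_continuous; case: (is_diff_phi lambda t).
Qed.

Lemma derive_dotv_phi (R : realType) (m n : nat) (lambda : 'I_m -> R)
    (nu : 'cV[R]_n) (f : 'cV[R]_m -> 'cV[R]_n) (t v : 'cV[R]_m) :
  differentiable f t ->
  'D_v (fun t => dotv nu (f t) * phi lambda t) t = phi lambda t *
    (dotv nu ('D_v f t) - dotv nu (f t) * dotv (\col_j lambda j) v).
Proof.
move=> df; rewrite [in RHS]deriveE//.
exact: derive_is_diff
  (is_diff_dotv_phi lambda nu (differentiableP df) (is_diff_id t)).
Qed.

Lemma C1_dotv_phi (R : realType) (m n : nat) (lambda : 'I_m -> R)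
    (nu : 'cV[R]_n) (f : 'cV[R]_m -> 'cV[R]_n) (U : set 'cV[R]_m) :
  open U -> C1_on U f -> C1_on U (fun t => dotv nu (f t) * phi lambda t).
Proof.
move=> oU [df cf]; split=> [t Ut|v t Ut].
  by have [] := is_diff_dotv_phi lambda nu (differentiableP (df t Ut))
    (is_diff_id t).
apply: (@continuous_near_eq _ _ _ (fun t => phi lambda t *
      (dotv nu ('D_v f t) - dotv nu (f t) * dotv (\col_j lambda j) v))).
  near=> s; rewrite derive_dotv_phi//; apply: df; near: s.
  exact: open_nbhs_nbhs.
apply: continuous_fun_mul; first exact: continuous_phi.
apply: continuous_fun_sub.
  apply: (@continuous_comp _ _ _ (fun t => 'D_v f t) (dotv nu)).
    exact: cf.
  exact: continuous_dotv.
apply: continuous_fun_mul; last exact: cst_continuous.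
apply: (@continuous_comp _ _ _ f (dotv nu)); last exact: continuous_dotv.
by apply: differentiable_continuous; exact: df.
Unshelve. all: by end_near.
Qed.

Lemma dotvD (R : realType) (n : nat) (u x y : 'cV[R]_n) :
  dotv u (x + y) = dotv u x + dotv u y.
Proof. by rewrite dotv_form linearD. Qed.

Lemma dotvB (R : realType) (n : nat) (u x y : 'cV[R]_n) :
  dotv u (x - y) = dotv u x - dotv u y.
Proof. by rewrite dotv_form linearB. Qed.

Lemma dotvZl (R : realType) (n : nat) (a : R) (u x : 'cV[R]_n) :
  dotv (a *: u) x = a * dotv u x.
Proof.
by rewrite /dotv mulr_sumr; apply: eq_bigr => i _; rewrite mxE mulrA.
Qed.

Lemma dotv0 (R : realType) (n : nat) (u : 'cV[R]_n) : dotv u 0 = 0.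
Proof. by rewrite dotv_form linear0. Qed.

Lemma form_delta (R : realType) (m : nat) (omega : 'I_m -> 'cV[R]_m -> R)
    (t : 'cV[R]_m) (j : 'I_m) : form omega t (delta_mx j 0) = omega j t.
Proof.
rewrite /form (bigD1 j)//= mxE !eqxx mulr1 big1 ?addr0// => k kj.
by rewrite mxE (negbTE kj) mulr0.
Qed.

Lemma dotv_delta (R : realType) (n : nat) (u : 'cV[R]_n) (i : 'I_n) :
  dotv u (delta_mx i 0) = u i 0.
Proof. by rewrite dotv_form form_delta. Qed.

Lemma dotv_common_eigenvector (R : realType) (m n : nat)
    (A : 'I_m -> 'M[R]_n) (nu : 'cV[R]_n) (lambda : 'I_m -> R) (j : 'I_m)
    (x : 'cV[R]_n) : is_common_eigenvector A nu lambda ->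
  dotv nu ((A j)^T *m x) = lambda j * dotv nu x.
Proof. by move=> [_ ev]; rewrite dotv_trmul ev dotvZl. Qed.

(** * The form omega and the first integral *)

(** The derivative of [phi] in [t_k] contributes [- lambda k * nu f_j], which is
    [- nu (A_k^T f_j)] by the eigenvector relation; what remains on both sides
    is the integrability condition paired with [nu]. *)
Lemma closed_dotv_phi (R : realType) (m n : nat) (A : 'I_m -> 'M[R]_n)
    (f : 'I_m -> 'cV[R]_m -> 'cV[R]_n) (T : set 'cV[R]_m)
    (nu : 'cV[R]_n) (lambda : 'I_m -> R) :
  (forall j, C1_on T (f j)) -> completely_solvable A f T ->
  is_common_eigenvector A nu lambda ->
  forall t, T t -> forall j k : 'I_m,
  'D_(delta_mx k 0) (fun t => dotv nu (f j t) * phi lambda t) t =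
  'D_(delta_mx j 0) (fun t => dotv nu (f k t) * phi lambda t) t.
Proof.
move=> C1f [_ solv] ev t Tt j k.
rewrite !derive_dotv_phi; try exact: (C1f _).1.
rewrite !dotv_delta !mxE; congr (_ * _).
have := congr1 (dotv nu) (solv t Tt j k).
rewrite !dotvB !(dotv_common_eigenvector _ _ ev).
by rewrite [lambda k * _]mulrC [lambda j * _]mulrC.
Qed.

Lemma is_diff_first_integral (R : realType) (m n : nat)
    (lambda : 'I_m -> R) (nu : 'cV[R]_n) (omega : 'I_m -> 'cV[R]_m -> R)
    (G : 'cV[R]_m -> R) (p : 'cV[R]_m * 'cV[R]_n) :
  is_diff (p.1) G (form omega p.1) ->
  is_diff p (fun q : 'cV[R]_m * 'cV[R]_n =>
      dotv nu q.2 * phi lambda q.1 - G q.1)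
    (fun v => phi lambda p.1 *
      (dotv nu v.2 - dotv nu p.2 * dotv (\col_j lambda j) v.1)
      - form omega p.1 v.1).
Proof.
move=> dG; apply: is_diffB.
  exact: (is_diff_dotv_phi lambda nu (is_diff_snd p) (is_diff_fst p)).
exact: is_diff_comp (is_diff_fst p) dG.
Qed.

Unset Implicit Arguments.

Theorem theorem2p7 (R : realType) (m n : nat)
    (T : set 'cV[R]_m) (hT : domain T)
    (A : 'I_m -> 'M[R]_n) (f : 'I_m -> 'cV[R]_m -> 'cV[R]_n)
    (hf : forall j, C1_on T (f j))
    (hsolv : completely_solvable A f T)
    (nu : 'cV[R]_n) (lambda : 'I_m -> R)
    (hnu : is_common_eigenvector A nu lambda)
    (U : set 'cV[R]_m) (hUT : U `<=` T)
    (hU : domain U) (hUsc : simply_connected U) :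
  let omega := fun (j : 'I_m) (t : 'cV[R]_m) =>
    dotv nu (f j t) * phi lambda t in
  (exists G : 'cV[R]_m -> R, primitive_on U omega G) /\
  (forall G : 'cV[R]_m -> R, primitive_on U omega G ->
     first_integral (fun j => (A j)^T) f (U `*` setT)
       (fun p => dotv nu p.2 * phi lambda p.1 - G p.1)).
Proof.
move=> omega.
have [_ oU _] := hU.
have C1f j : C1_on U (f j).
  by have [d c] := hf j; split=> [t /hUT|v t /hUT]; [exact: d|exact: c].
have C1omega j : C1_on U (omega j) by exact: C1_dotv_phi.
split.
  apply: closed_form_primitive => // t /hUT Tt j k.
  exact: closed_dotv_phi hf hsolv hnu t Tt j k.
move=> G HG.
have dF p (Up : U p.1) := is_diff_first_integral lambda nu (HG _ Up).
have DF p v (Up : U p.1) := derive_is_diff v (dF p Up).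
split.
  split=> [p [Up _]|v p [Up _]]; first by case: (dF p Up).
  apply: (@continuous_near_eq _ _ _ (fun q : 'cV[R]_m * 'cV[R]_n =>
    phi lambda q.1 *
      (dotv nu v.2 - dotv nu q.2 * dotv (\col_j lambda j) v.1)
      - form omega q.1 v.1)).
    near=> q; rewrite DF//; near: q.
    have : \forall t \near p.1, U t by exact: open_nbhs_nbhs.
    exact: cvg_fst.
  apply: continuous_fun_sub.
    apply: continuous_fun_mul.
      apply: (@continuous_comp _ _ _ fst (phi lambda)); first exact: cvg_fst.
      by apply: continuous_phi.
    apply: continuous_fun_sub; first exact: cst_continuous.
    apply: continuous_fun_mul; last exact: cst_continuous.
    apply: (@continuous_comp _ _ _ snd (dotv nu)); first exact: cvg_snd.
    exact: continuous_dotv.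
  apply: (@continuous_form _ _ _ omega fst (fun=> v.1)).
  - by move=> j; apply: differentiable_continuous; exact: (C1omega j).1.
  - exact: cvg_fst.
  - exact: cst_continuous.
move=> p [Up _] j.
rewrite DF//=.
under eq_bigr => i _ do rewrite DF//=.
rewrite !dotv0 dotv_delta mxE form_delta linear0 mulr0.
(* The spatial part is [phi] times the pairing of [nu] with the right-hand
   side of the system, to which the eigenvector relation applies. *)
have -> : \sum_(i < n) ((A j)^T *m p.2 + f j p.1) i 0 *
      (phi lambda p.1 * (dotv nu (delta_mx i 0) - 0) - 0) =
    phi lambda p.1 * dotv nu ((A j)^T *m p.2 + f j p.1).
  rewrite [in RHS]/dotv mulr_sumr; apply: eq_bigr => i _.
  by rewrite dotv_delta !subr0 mulrC mulrA.
rewrite dotvD (dotv_common_eigenvector _ _ hnu) /omega; ring.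
Unshelve. all: by end_near.
Qed.
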